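(* Let $B=B(\theta,A_1,A_2)=(R_\theta\otimes \mathbf I_m)(A_1\oplus A_2)\in\mathbb{R}^{2m\times 2m}$, where $A_1,A_2\in\mathbb{R}^{m\times m}$ and $|\tan\theta|\neq 1$. Let $P_kA_k=L_kU_k$ be the GEPP factorization of $A_k$ for each $k=1,2$ (where $|(L_k)_{ij}|<1$ for $i>j$). Then $PB=LU$ is the GEPP factorization of $B$, where \[ P=(P_1\oplus P_2)(P_\theta\otimes \mathbf I_m), \] \[ L=(P_1\oplus P_2)(L_{\hat\theta}\otimes \mathbf I_m)(P_1^T\oplus P_2^T)(L_1\oplus L_2)=\begin{bmatrix} L_1 & \mathbf 0\\ -\tan\hat\theta\,P_2P_1^TL_1 & L_2\end{bmatrix}, \] \[ U=(L_1^{-1}\oplus L_2^{-1})(P_1\oplus P_2)(U_{\hat\theta}D_\theta\otimes \mathbf I_m)(A_1\oplus A_2)=\begin{bmatrix} (-1)^{e(\theta)}\cos\hat\theta\,U_1 & \sin\hat\theta\,U_1A_1^{-1}A_2\\ \mathbf 0 & \sec\hat\theta\,U_2\end{bmatrix}. \]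
   Context: GEPP is Gaussian elimination with partial pivoting: at step $k$, the row $i_k=\min(\arg\max_{j\ge k}|A^{(k)}_{jk}|)$ of the current intermediate matrix is swapped with row $k$ and then the entries below the diagonal in column $k$ are eliminated. It yields the GEPP factorization $PA=LU$ with $P$ a permutation matrix, $L$ unit lower triangular with $|L_{ij}|\le 1$, and $U$ upper triangular. $\otimes$ is the Kronecker product of matrices, $A\oplus B$ is the block diagonal matrix with blocks $A,B$, and $\mathbf I_m$ is the $m\times m$ identity. Notation: $R_\theta=\begin{bmatrix}\cos\theta&\sin\theta\\-\sin\theta&\cos\theta\end{bmatrix}$, $L_\theta=\begin{bmatrix}1&0\\-\tan\theta&1\end{bmatrix}$, $U_\theta=\begin{bmatrix}\cos\theta&\sin\theta\\0&\sec\theta\end{bmatrix}$. The pivot indicator is $e(\theta)=1$ if $|\tan\theta|>1$ (equivalently $|\cos\theta|<|\sin\theta|$) and $e(\theta)=0$ if $|\tan\theta|\le 1$. $P_\theta=\begin{bmatrix}0&1\\1&0\end{bmatrix}^{e(\theta)}$, $D_\theta=\begin{bmatrix}-1&0\\0&1\end{bmatrix}^{e(\theta)}$, and $\hat\theta=\theta$ if $e(\theta)=0$, $\hat\theta=\frac{\pi}{2}-\theta$ if $e(\theta)=1$. *)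

(* Defs.v *)
From HB Require Import structures.
From mathcomp Require Import all_boot all_order all_algebra.
From mathcomp Require Import mxtens.
From mathcomp Require Import reals trigo.

Set Implicit Arguments.
Unset Strict Implicit.
Unset Printing Implicit Defensive.

Import Order.TTheory GRing.Theory Num.Theory.
Local Open Scope ring_scope.

Section GEPP.
Variables (R : realFieldType) (n : nat).
Implicit Types (A P L U W : 'M[R]_n) (k : 'I_n).

Definition pivot_argmax W k : {set 'I_n} :=
  [set i : 'I_n | (k <= i)%N &
     [forall j : 'I_n, (k <= j)%N ==> (`|W j k| <= `|W i k|)]].

(* The least element of the (always nonempty) set pivot_argmax W k, so the
   default value k of odflt is never used. *)
Definition pivot_row W k : 'I_n :=
  odflt k [pick i in pivot_argmax W k |
             [forall j in pivot_argmax W k, (i <= j)%N]].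

(* The state (P, L, W) holds the accumulated row permutation P, the unit lower
   triangular matrix L of the multipliers found so far (permuted along with
   the rows), and the intermediate matrix W; the invariant is
   P *m A = L *m W, where A is the input. The matrix 1%:M - E eliminates
   the entries of T *m W below the diagonal in column k; its inverse is
   1%:M + E because E *m E = 0. *)
Definition gepp_step (S : 'M[R]_n * 'M[R]_n * 'M[R]_n) k :
    'M[R]_n * 'M[R]_n * 'M[R]_n :=
  let: (P, L, W) := S in
  let T := tperm_mx k (pivot_row W k) in
  let W' := T *m W in
  let E := \matrix_(i, j)
             (if (j == k) && (k < i)%N then W' i k / W' k k else 0) in
  (T *m P, T *m L *m T *m (1%:M + E), (1%:M - E) *m W').

(* The last step k = n - 1 (in 0-based numbering) changes nothing. *)
Definition gepp A : 'M[R]_n * 'M[R]_n * 'M[R]_n :=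
  foldl gepp_step (1%:M, 1%:M, A) (enum 'I_n).

(* Row k is not modified after step k, so U k k is the pivot by which step k
   divides. The second conjunct says that these divisions (at all steps but
   the last, which performs none) are legitimate; without it x / 0 = 0 would
   assign a meaningless outcome to some singular matrices. It holds for every
   invertible A. *)
Definition is_gepp A P L U : Prop :=
  gepp A = (P, L, U) /\ (forall k, (k.+1 < n)%N -> U k k != 0).

End GEPP.

Definition mx2 (R : nzRingType) (a b c d : R) : 'M[R]_2 :=
  \matrix_(i < 2, j < 2)
    if i == 0 then (if j == 0 then a else b)
    else (if j == 0 then c else d).

Definition dsum (R : nzRingType) (m : nat) (A1 A2 : 'M[R]_m) : 'M[R]_(m + m) :=
  block_mx A1 0 0 A2.

Fact mul2_addnn (m : nat) : (2 * m = m + m)%N.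
Proof. by rewrite mul2n addnn. Qed.

(* The Kronecker product of X with the identity of size m; the cast is needed
   because 2 * m and m + m are not convertible. *)
Definition kron_id (R : nzRingType) (X : 'M[R]_2) (m : nat) : 'M[R]_(m + m) :=
  castmx (mul2_addnn m, mul2_addnn m)
    (tensmx X (1%:M : 'M[R]_m)).

Section Rotation.
Variable R : realType.
Implicit Type theta : R.

Definition rot_mx theta : 'M[R]_2 :=
  mx2 (cos theta) (sin theta) (- sin theta) (cos theta).

Definition rotL_mx theta : 'M[R]_2 := mx2 1 0 (- tan theta) 1.

Definition rotU_mx theta : 'M[R]_2 :=
  mx2 (cos theta) (sin theta) 0 (cos theta)^-1.

(* The condition |tan theta| > 1 is expressed by |cos theta| < |sin theta| so
   that cos theta = 0 (infinite tangent) is covered: the library sets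
   tan theta = 0 there. *)
Definition pivot_ind theta : nat := (`|cos theta| < `|sin theta|)%R.

Definition rotP_mx theta : 'M[R]_2 := mx2 0 1 1 0 ^+ pivot_ind theta.

Definition rotD_mx theta : 'M[R]_2 := mx2 (-1) 0 0 1 ^+ pivot_ind theta.

Definition hat_angle theta : R :=
  if pivot_ind theta == 1%N then pi / 2 - theta else theta.

End Rotation.

(* Main.v *)
Require Import Defs.
From mathcomp Require Import all_boot all_order all_algebra.
From mathcomp Require Import reals trigo.
From mathcomp Require Import perm mxtens.

Set Implicit Arguments.
Unset Strict Implicit.
Unset Printing Implicit Defensive.

Import Order.TTheory GRing.Theory Num.Theory.
Local Open Scope ring_scope.

(** Partial pivoting has no freedom when no two candidate pivots tie.  If
    [P *m A = L *m U] with [P] a permutation matrix, [L] unit lower triangular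
    with all subdiagonal entries of absolute value less than 1, [U] upper
    triangular, and nonzero pivots [U k k] (except perhaps the last), then at
    step [k] the candidate pivots are the numbers [L i k * U k k] with [k <= i],
    in some order; the one with [i = k] is the strict maximum, and the algorithm
    has to bring that row up.  Hence the algorithm returns [(P, L, U)]; this is
    [strict_PLU_is_gepp].  Conversely, whatever the algorithm returns is a
    factorization with these triangular shapes ([gepp_PLU]).

    The proposition thus reduces to algebra.  The 2 x 2 identity
    [rotP_mx theta *m rot_mx theta = rotL_mx that *m (rotU_mx that *m rotD_mx
    theta)], where [that] is the hat angle, is the factorization of the rotation
    itself ([rotPR_LUD]).  Tensored with the identity and combined with the
    factorizations of [A1] and [A2], it gives [P *m B = L *m U].  The block
    forms of [L] and [U] show their triangular shapes; the subdiagonal entries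
    of [L] are those of [L1] and [L2], and entries of a row permutation of [L1]
    times the tangent of the hat angle, which is less than 1 in absolute value;
    the diagonal of [U] consists of nonzero multiples of the diagonal of [U1],
    which has no zero as [A1] is invertible, and of that of [U2].  By uniqueness this factorization is the one that the algorithm
    finds.

    The strictness matters when the first pivot comes from the lower half of
    [B]: the swaps then scatter the rows of the other half, so that
    tie-breaking by least index need not agree with that in [A1] and [A2]. *)

(** * The elimination loop and its result *)

Lemma gepp_ind (R : realFieldType) (n : nat) (A : 'M[R]_n)
    (Inv : nat -> 'M[R]_n * 'M[R]_n * 'M[R]_n -> Prop) :
  Inv 0%N (1%:M, 1%:M, A) ->
  (forall (k : 'I_n) S, Inv k S -> Inv k.+1 (gepp_step S k)) ->
  Inv n (gepp A).
Proof.
move=> Inv0 InvS; rewrite /gepp.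
suff H j : (j <= n)%N ->
    Inv j (foldl (@gepp_step R n) (1%:M, 1%:M, A) (take j (enum 'I_n))).
  by have := H n (leqnn n); rewrite take_oversize ?size_enum_ord.
elim: j => [|j IHj] ltjn; first by rewrite take0.
rewrite (take_nth (Ordinal ltjn)) ?size_enum_ord // -cats1 foldl_cat /=.
rewrite (nth_ord_enum _ (Ordinal ltjn)).
exact: (InvS (Ordinal ltjn) _ (IHj (ltnW ltjn))).
Qed.

Lemma pivot_rowP (R : realFieldType) (n : nat) (W : 'M[R]_n) (k : 'I_n) :
  pivot_row W k \in pivot_argmax W k.
Proof.
have [i0 i0max] : exists i, i \in pivot_argmax W k.
  have [/= i leki imax] :=
    @Order.TotalTheory.arg_maxP _ _ _ k (fun i : 'I_n => (k <= i)%N)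
      (fun i => `|W i k|) (leqnn k).
  exists i; rewrite inE leki /=.
  by apply/forallP => j; apply/implyP => /imax.
rewrite /pivot_row; case: pickP => [p /andP[] // | none] /=.
case: (@arg_minnP _ i0 (mem (pivot_argmax W k)) (@nat_of_ord n) i0max) => i.
move=> imax imin.
have /negP[] := negbT (none i); apply/andP; split=> //.
by apply/forallP => j; apply/implyP => /imin.
Qed.

(** The matrix of multipliers of one elimination step has this shape. *)
Lemma mulmx_col_supp (R : pzRingType) (n : nat) (E X : 'M[R]_n) (k : 'I_n) :
  (forall i j, j != k -> E i j = 0) ->
  forall i j, (E *m X) i j = E i k * X k j.
Proof.
move=> E0 i j; rewrite mxE (bigD1 k) //= big1 ?addr0 // => l /(E0 i) ->.
by rewrite mul0r.
Qed.

(** The nonzero rows of [E] only meet identity columns of [X]: multipliers of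
    step [k] are simply appended to the triangular factor of the earlier ones. *)
Lemma mulmx_id_cols (R : pzRingType) (n : nat) (E X : 'M[R]_n) (k : 'I_n) :
  (forall i j : 'I_n, (i <= k)%N -> E i j = 0) ->
  (forall i j : 'I_n, (k < j)%N -> X i j = (i == j)%:R) ->
  X *m E = E.
Proof.
move=> E0 X1; rewrite -[RHS]mul1mx; apply/matrixP => i j; rewrite !mxE.
apply: eq_bigr => l _; have [/E0-> | ltkl] := leqP l k; first by rewrite !mulr0.
by rewrite X1 // mxE.
Qed.

Lemma mul1Dmx_nil (R : pzRingType) (n : nat) (E : 'M[R]_n) :
  E *m E = 0 -> (1%:M + E) *m (1%:M - E) = 1%:M.
Proof.
by move=> EE0; rewrite mulmxBr mulmx1 mulmxDl mul1mx EE0 addr0 addrK.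
Qed.

Lemma tperm_mxK (R : pzRingType) (n : nat) (k p : 'I_n) :
  tperm_mx k p *m tperm_mx k p = 1%:M :> 'M[R]_n.
Proof. by rewrite -perm_mxM tperm2 perm_mx1. Qed.

Definition unit_lower (R : pzRingType) (n : nat) (L : 'M[R]_n) :=
  forall i j : 'I_n, (i <= j)%N -> L i j = (i == j)%:R.

Definition upper (R : pzRingType) (n : nat) (U : 'M[R]_n) :=
  forall i j : 'I_n, (j < i)%N -> U i j = 0.

(** The loop keeps [P *m A = L *m W], where the columns of [L] from [k] on are
    still those of the identity and the first [k] columns of [W] are reduced.
    Exchanging two rows from [k] on preserves both shapes.  A zero pivot does no
    harm: being of maximal absolute value, it heads a column that is already
    zero. *)
Lemma gepp_PLU (R : realFieldType) (n : nat) (A P L U : 'M[R]_n) :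
  gepp A = (P, L, U) ->
  [/\ is_perm_mx P, unit_lower L, upper U & P *m A = L *m U].
Proof.
pose Inv (k : nat) (S : 'M[R]_n * 'M[R]_n * 'M[R]_n) :=
  let: (P, L, W) := S in
  [/\ is_perm_mx P,
      forall i j : 'I_n, (i <= j)%N || (k <= j)%N -> L i j = (i == j)%:R,
      forall i j : 'I_n, (j < k)%N -> (j < i)%N -> W i j = 0
    & P *m A = L *m W].
suff: Inv n (gepp A).
  move=> + gA; rewrite gA => -[hP hL hU hPA]; split=> // i j ltij.
    by apply: hL; rewrite ltij.
  by apply: hU.
apply: gepp_ind => [|k [[P' L'] W]].
  split=> //; first exact: is_perm_mx1.
    by move=> i j _; rewrite mxE.
rewrite /Inv /gepp_step => -[hP hL hW hPA].
have := pivot_rowP W k; set p := pivot_row W k; set T := tperm_mx k p.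
rewrite inE => /andP[lekp /forallP pmax].
set W' := T *m W; set E := (X in 1%:M + X).
have W'E i j : W' i j = W (tperm k p i) j by rewrite /W' -xrowE !mxE.
have le_tk (i : 'I_n) : (k <= i)%N -> (k <= tperm k p i)%N.
  by case: tpermP => // ->.
have Esupp i j : j != k -> E i j = 0 by move=> /negbTE njk; rewrite mxE njk.
have Elow (i j : 'I_n) : (i <= k)%N -> E i j = 0.
  by move=> leik; rewrite mxE [(k < i)%N]ltnNge leik andbF.
have EE0 : E *m E = 0.
  apply/matrixP => i j.
  by rewrite (mulmx_col_supp _ Esupp) [E k j]Elow // mulr0 mxE.
set M := T *m L' *m T.
have ME i j : M i j = L' (tperm k p i) (tperm k p j).
  by rewrite /M -xcolE -xrowE !mxE.
have hM (i j : 'I_n) : (i <= j)%N || (k <= j)%N -> M i j = (i == j)%:R.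
  move=> ij; rewrite ME.
  have [lekj | ltjk] := leqP k j.
    by rewrite hL ?le_tk ?orbT // (inj_eq perm_inj).
  move: ij; rewrite [(k <= j)%N]leqNgt ltjk orbF => leij.
  have fix_lt (l : 'I_n) : (l < k)%N -> tperm k p l = l.
    move=> ltlk; apply: tpermD.
      by apply: contraTneq ltlk => <-; rewrite ltnn.
    by apply: contraTneq ltlk => <-; rewrite -leqNgt.
  by rewrite !fix_lt ?(leq_ltn_trans leij) // hL ?leij.
have MEE : M *m (1%:M + E) = M + E.
  rewrite mulmxDr mulmx1 (mulmx_id_cols Elow) // => i j ltkj.
  by rewrite hM // (ltnW ltkj) orbT.
split.
- by rewrite is_perm_mxMl // perm_mx_is_perm.
- move=> i j ij; rewrite MEE mxE hM; last first.
    by case/orP: ij => [-> //|/ltnW->]; rewrite orbT.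
  suff ->: E i j = 0 by rewrite addr0.
  have [ejk | /Esupp //] := eqVneq j k.
  by case/orP: ij; rewrite ejk ?ltnn // => /Elow.
- move=> i j; rewrite ltnS leq_eqVlt => lejk ltji.
  have -> : ((1%:M - E) *m W') i j = W' i j - E i k * W' k j.
    rewrite -(mulmx_col_supp _ Esupp) mulmxBl mul1mx [LHS]mxE.
    by congr (_ + _); rewrite mxE.
  case/orP: lejk => [/eqP/val_inj ejk | ltjk]; last first.
    have W'0 (l : 'I_n) : (j < l)%N -> W' l j = 0.
      move=> ltjl; rewrite W'E hW //; case: tpermP => // _.
      exact: leq_trans ltjk lekp.
    by rewrite [W' k j]W'0 // mulr0 subr0 W'0.
  rewrite {}ejk in ltji *.
  have -> : E i k = W' i k / W' k k by rewrite [LHS]mxE eqxx ltji.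
  have [W'kk0 | nz] := eqVneq (W' k k) 0; last by rewrite divfK ?subrr.
  rewrite W'kk0 mulr0 subr0; apply/eqP; rewrite -normr_le0.
  have := pmax (tperm k p i); rewrite le_tk 1?ltnW //= -W'E.
  by move: W'kk0; rewrite W'E tpermL => ->; rewrite normr0.
- rewrite -mulmxA hPA /W' -!mulmxA (mulmxA (1%:M + E)) mul1Dmx_nil //.
  by rewrite mul1mx !mulmxA -(mulmxA _ T T) tperm_mxK mulmx1.
Qed.

(** * Uniqueness in the absence of ties *)

(** [lead_cols L k] and [trail_cols L k] are the factors of [L] that the first
    [k] elimination steps have produced and that the later steps will produce. *)
Definition lead_cols (R : pzRingType) (n : nat) (L : 'M[R]_n) (k : nat) :=
  \matrix_(i, j) (if (j < k)%N then L i j else (i == j)%:R).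

Definition trail_cols (R : pzRingType) (n : nat) (L : 'M[R]_n) (k : nat) :=
  \matrix_(i, j) (if (j < k)%N then (i == j)%:R else L i j).

Definition subdiag_col (R : pzRingType) (n : nat) (L : 'M[R]_n) (k : 'I_n) :=
  \matrix_(i, j) (if (j == k) && (k < i)%N then L i j else 0).

Lemma subdiag_col_supp (R : pzRingType) (n : nat) (L : 'M[R]_n) (k i j : 'I_n) :
  j != k -> subdiag_col L k i j = 0.
Proof. by move=> /negbTE njk; rewrite mxE njk. Qed.

(** In the product, the left factor acts on the new column as the identity,
    because the columns of [lead_cols L k] from [k] on are those of the
    identity. *)
Lemma lead_colsS (R : pzRingType) (n : nat) (L : 'M[R]_n) (k : 'I_n) :
  unit_lower L ->
  lead_cols L k *m (1%:M + subdiag_col L k) = lead_cols L k.+1.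
Proof.
move=> hL; rewrite mulmxDr mulmx1 (@mulmx_id_cols _ _ _ _ k).
- apply/matrixP => i j; rewrite !mxE ltnS [(j <= k)%N]leq_eqVlt val_eqE.
  have [-> | njk] := eqVneq j k; last by rewrite /= addr0.
  rewrite ltnn /=; have [ltki | leik] := ltnP k i.
    by rewrite -val_eqE gtn_eqF // add0r.
  by rewrite addr0 hL.
- by move=> i j leik; rewrite mxE [(k < i)%N]ltnNge leik andbF.
- by move=> i j ltkj; rewrite mxE ltnNge ltnW.
Qed.

(** Row [k] of [trail_cols L k] is a row of the identity, so that subtracting
    multiples of it from the rows below only clears the entries of column [k]. *)
Lemma trail_colsS (R : pzRingType) (n : nat) (L : 'M[R]_n) (k : 'I_n) :
  unit_lower L ->
  (1%:M - subdiag_col L k) *m trail_cols L k = trail_cols L k.+1.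
Proof.
move=> hL; rewrite mulmxBl mul1mx; apply/matrixP => i j.
rewrite [LHS]mxE [X in _ + X]mxE.
rewrite (mulmx_col_supp _ (@subdiag_col_supp _ _ L k)) !mxE ltnS.
rewrite [(j <= k)%N]leq_eqVlt val_eqE.
rewrite eqxx /=; have [-> | njk] := eqVneq j k.
  rewrite ltnn /= (hL _ _ (leqnn k)) eqxx mulr1; case: ltnP => [ltki | leik].
    by rewrite subrr -val_eqE gtn_eqF.
  by rewrite subr0 hL.
case: ltnP => [ltjk | lekj]; first by rewrite mulr0 subr0.
by rewrite (hL _ _ lekj) [k == j]eq_sym (negbTE njk) mulr0 subr0.
Qed.

(** Once [k] columns are eliminated, what is left of column [k] is the pivot
    times the corresponding column of [L]: the comparison of candidate pivots
    is a comparison of entries of [L]. *)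
Lemma trail_cols_mul_col (R : pzRingType) (n : nat) (L U : 'M[R]_n)
    (k i : 'I_n) :
  upper U -> (k <= i)%N ->
  (trail_cols L k *m U) i k = L i k * U k k.
Proof.
move=> hU leki; rewrite mxE (bigD1 k) //= mxE ltnn big1 ?addr0 // => j njk.
rewrite mxE; case: ltnP => [ltjk | lekj].
  by rewrite -val_eqE gtn_eqF ?mul0r // (leq_trans ltjk).
by rewrite hU ?mulr0 // ltn_neqAle lekj andbT val_eqE eq_sym.
Qed.

Lemma perm_fixing_lt (n : nat) (s : 'S_n) (k : nat) :
  (forall i : 'I_n, (i < k)%N -> s i = i) ->
  forall i : 'I_n, (k <= s i)%N = (k <= i)%N.
Proof.
move=> sfix i; apply/idP/idP; apply: contraLR; rewrite -!ltnNge.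
  by move=> ltik; rewrite sfix.
by move=> ltsik; rewrite -(perm_inj (sfix _ ltsik)).
Qed.

(** After [k] steps the state is, up to a permutation [s] of the rows from [k]
    on, the one determined by [P], [L] and [U].  The strict maximality of the
    pivot makes the algorithm select the row [s k], which is the row that the
    factorization has in position [k]; the swap then makes the remaining
    permutation fix [k] too.  At the last step [s] is already the identity and
    there is nothing to compare; hence the restriction [k.+1 < n]. *)
Lemma strict_PLU_is_gepp (R : realFieldType) (n : nat) (A P L U : 'M[R]_n) :
  is_perm_mx P -> unit_lower L -> upper U -> P *m A = L *m U ->
  (forall i j : 'I_n, (j < i)%N -> `|L i j| < 1) ->
  (forall k : 'I_n, (k.+1 < n)%N -> U k k != 0) ->
  is_gepp A P L U.
Proof.
move=> /is_perm_mxP[s0 defP] hL hU hPA Llt1 Unz; split=> //.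
pose Inv (k : nat) (S : 'M[R]_n * 'M[R]_n * 'M[R]_n) :=
  let: (P', L', W) := S in
  exists s : 'S_n, [/\ forall i : 'I_n, (i < k)%N -> s i = i,
      perm_mx s *m P' = P,
      perm_mx s *m L' *m (perm_mx s)^T = lead_cols L k
    & perm_mx s *m W = trail_cols L k *m U].
suff: Inv n (gepp A).
  case: (gepp A) => [[P' L'] W] [s [sfix]].
  have -> : s = 1%g by apply/permP => i; rewrite sfix // perm1.
  rewrite perm_mx1 trmx1 !mul1mx mulmx1 => -> -> ->.
  have -> : lead_cols L n = L by apply/matrixP => i j; rewrite mxE ltn_ord.
  have -> : trail_cols L n = 1%:M.
    by apply/matrixP => i j; rewrite !mxE ltn_ord.
  by rewrite mul1mx.
apply: gepp_ind => [|k [[P' L'] W] [s [sfix sP sL sW]]].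
  exists s0; split=> //; first by rewrite mulmx1.
    rewrite mulmx1 tr_perm_mx -perm_mxM mulgV perm_mx1.
    by apply/matrixP => i j; rewrite !mxE.
  rewrite -defP hPA; congr (_ *m _).
  by apply/matrixP => i j; rewrite !mxE.
have sge := perm_fixing_lt sfix.
have WsE (i : 'I_n) : (k <= i)%N -> W (s i) k = L i k * U k k.
  by move=> leki; rewrite -(trail_cols_mul_col _ hU leki) -sW -row_permE mxE.
have Lkk : L k k = 1 by rewrite hL // eqxx.
(* A row [s i] with [k < i] is strictly beaten by the row [s k]. *)
have pE : pivot_row W k = s k.
  have := pivot_rowP W k; rewrite inE => /andP[].
  have [i ->] : exists i, pivot_row W k = s i.
    by exists ((s^-1)%g (pivot_row W k)); rewrite permKV.
  rewrite sge => leki /forallP/(_ (s k)); rewrite sge leqnn /= !WsE // Lkk mul1r.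
  have [-> // | nik] := eqVneq i k.
  have ltki : (k < i)%N by rewrite ltn_neqAle eq_sym nik.
  rewrite normrM leNgt gtr_pMl ?Llt1 // normr_gt0 Unz //.
  exact: leq_ltn_trans ltki (ltn_ord i).
rewrite /gepp_step pE; set T := tperm_mx k (s k).
set W' := T *m W; set E := (X in 1%:M + X).
pose s' := (s * tperm k (s k))%g.
have s'E : perm_mx s' = perm_mx s *m T by rewrite perm_mxM.
have s'k : s' k = k by rewrite permM tpermR.
have s'fix (i : 'I_n) : (i < k.+1)%N -> s' i = i.
  rewrite ltnS leq_eqVlt => /predU1P[/val_inj-> // | ltik].
  rewrite permM (sfix _ ltik) tpermD //.
    by apply: contraTneq ltik => <-; rewrite ltnn.
  by apply: contraTneq ltik => <-; rewrite -leqNgt sge.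
have s'gt := perm_fixing_lt s'fix.
have s'W : perm_mx s' *m W' = trail_cols L k *m U.
  by rewrite s'E -mulmxA (mulmxA T) tperm_mxK mul1mx.
have W'E (i : 'I_n) : (k <= i)%N -> W' (s' i) k = L i k * U k k.
  move=> leki; rewrite -(trail_cols_mul_col _ hU leki) -s'W -row_permE.
  by rewrite [RHS]mxE.
(* The multipliers found by the algorithm are those of [L], as the pivots
   cancel. *)
have s'E' : perm_mx s' *m E *m (perm_mx s')^T = subdiag_col L k.
  rewrite tr_perm_mx -row_permE -col_permE; apply/matrixP => i j.
  do 3 rewrite [LHS]mxE; rewrite [RHS]mxE s'gt -{1}s'k (inj_eq perm_inj).
  have [-> /= | //] := eqVneq j k; case: ltnP => // ltki.
  rewrite -{2}s'k !W'E ?(ltnW ltki) // Lkk mul1r mulfK // Unz //.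
  exact: leq_ltn_trans ltki (ltn_ord i).
have s'V : (perm_mx s')^T *m perm_mx s' = 1%:M :> 'M[R]_n.
  by rewrite tr_perm_mx -perm_mxM mulVg perm_mx1.
have s'V' : perm_mx s' *m (perm_mx s')^T = 1%:M :> 'M[R]_n.
  by rewrite tr_perm_mx -perm_mxM mulgV perm_mx1.
exists s'; split=> //.
- by rewrite s'E -mulmxA (mulmxA T) tperm_mxK mul1mx.
- rewrite -lead_colsS // -s'E' -sL.
  have sT : (perm_mx s)^T *m perm_mx s' = T.
    by rewrite s'E mulmxA tr_perm_mx -perm_mxM mulVg perm_mx1 mul1mx.
  have -> : 1%:M + perm_mx s' *m E *m (perm_mx s')^T
            = perm_mx s' *m (1%:M + E) *m (perm_mx s')^T.
    by rewrite mulmxDr mulmx1 mulmxDl s'V'.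
  rewrite !mulmxA -(mulmxA _ _ (perm_mx s')) sT {1}s'E.
  by rewrite -(mulmxA _ T T) tperm_mxK mulmx1.
- rewrite -trail_colsS // -mulmxA -s'W -s'E' !mulmxBl mul1mx mulmxBr !mul1mx.
  by rewrite -!mulmxA (mulmxA _ (perm_mx s')) s'V mul1mx !mulmxA.
Qed.

(** * Block matrices *)

Lemma kron_idE (R : nzRingType) (m : nat) (a b c d : R) :
  kron_id (mx2 a b c d) m = block_mx a%:M b%:M c%:M d%:M.
Proof.
apply/matrixP => i j; rewrite castmxE mxE -[i]splitK -[j]splitK.
have quo (x : 'I_m) : (x %/ m)%N = 0%N by rewrite divn_small.
have quo' (x : 'I_m) : ((m + x) %/ m)%N = 1%N.
  by rewrite divnDl ?divnn ?quo ?addn0 // (leq_ltn_trans _ (ltn_ord x)).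
have rem (x : 'I_m) : (x %% m)%N = x by rewrite modn_small.
have rem' (x : 'I_m) : ((m + x) %% m)%N = x by rewrite modnDl modn_small.
case: (split i) => x; case: (split j) => y /=;
  rewrite ?(block_mxEul, block_mxEur, block_mxEdl, block_mxEdr) !mxE;
  rewrite -!val_eqE /= ?quo ?quo' ?rem ?rem' /= mulr_natr //.
Qed.

Lemma kron_idM (R : comNzRingType) (m : nat) (X Y : 'M[R]_2) :
  kron_id (X *m Y) m = kron_id X m *m kron_id Y m.
Proof.
rewrite /kron_id.
have -> : tensmx (X *m Y) (1%:M : 'M[R]_m) = tensmx X 1%:M *m tensmx Y 1%:M.
  by rewrite tensmx_mul mulmx1.
by case: _ / mul2_addnn.
Qed.

Lemma mulmx_mx2 (R : nzRingType) (a b c d a' b' c' d' : R) :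
  mx2 a b c d *m mx2 a' b' c' d'
  = mx2 (a * a' + b * c') (a * b' + b * d') (c * a' + d * c') (c * b' + d * d').
Proof.
apply/matrixP => i j; rewrite !mxE !big_ord_recl big_ord0 !mxE /= addr0.
by case: (i == 0); case: (j == 0).
Qed.

Lemma mx2_1 (R : nzRingType) : mx2 1 0 0 1 = 1%:M :> 'M[R]_2.
Proof.
by apply/matrixP => i j; rewrite !mxE; case: i j => [[|[]] // ?] [[|[]] // ?].
Qed.

Lemma dsumM (R : nzRingType) (m : nat) (X1 X2 Y1 Y2 : 'M[R]_m) :
  dsum (X1 *m Y1) (X2 *m Y2) = dsum X1 X2 *m dsum Y1 Y2.
Proof. by rewrite /dsum mulmx_block !mulmx0 !mul0mx !addr0 add0r. Qed.

Lemma dsum1 (R : nzRingType) (m : nat) : dsum 1%:M 1%:M = 1%:M :> 'M[R]_(m + m).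
Proof. by rewrite /dsum -scalar_mx_block. Qed.

Lemma is_perm_mx_inj (R : nzRingType) (n : nat) (f : 'I_n -> 'I_n)
    (A : 'M[R]_n) :
  injective f -> (forall i j, A i j = (f i == j)%:R) -> is_perm_mx A.
Proof.
move=> fI AE; apply/is_perm_mxP; exists (perm fI).
by apply/matrixP => i j; rewrite AE !mxE permE.
Qed.

Lemma dsum_is_perm (R : nzRingType) (m : nat) (P1 P2 : 'M[R]_m) :
  is_perm_mx P1 -> is_perm_mx P2 -> is_perm_mx (dsum P1 P2).
Proof.
move=> /is_perm_mxP[s1 ->] /is_perm_mxP[s2 ->].
pose f (i : 'I_(m + m)) : 'I_(m + m) :=
  match split i with inl x => lshift m (s1 x) | inr y => rshift m (s2 y) end.
apply: (@is_perm_mx_inj _ _ f).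
  move=> i j; rewrite /f -[i]splitK -[j]splitK !unsplitK.
  case: (split i) (split j) => [x | x] [y | y] /= /eqP;
  by rewrite ?(eq_lshift, eq_rshift, eq_lrshift, eq_rlshift) // => /eqP/perm_inj->.
move=> i j; rewrite /f -[i]splitK -[j]splitK !unsplitK.
by case: (split i) (split j) => [x | x] [y | y] /=;
  rewrite ?(block_mxEul, block_mxEur, block_mxEdl, block_mxEdr) !mxE
    ?(eq_lshift, eq_rshift, eq_lrshift, eq_rlshift).
Qed.

Lemma swap_is_perm (R : nzRingType) (m : nat) :
  is_perm_mx (block_mx 0 1%:M 1%:M 0 : 'M[R]_(m + m)).
Proof.
pose f (i : 'I_(m + m)) : 'I_(m + m) :=
  match split i with inl x => rshift m x | inr y => lshift m y end.
apply: (@is_perm_mx_inj _ _ f).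
  move=> i j; rewrite /f -[i]splitK -[j]splitK !unsplitK.
  case: (split i) (split j) => [x | x] [y | y] /= /eqP;
  by rewrite ?(eq_lshift, eq_rshift, eq_lrshift, eq_rlshift) // => /eqP->.
move=> i j; rewrite /f -[i]splitK -[j]splitK !unsplitK.
by case: (split i) (split j) => [x | x] [y | y] /=;
  rewrite ?(block_mxEul, block_mxEur, block_mxEdl, block_mxEdr) !mxE
    ?(eq_lshift, eq_rshift, eq_lrshift, eq_rlshift).
Qed.

(** * The factorization of a rotation *)

(** Replacing an angle by its complement inverts the tangent; this covers
    [cos theta = 0], where the complement has tangent 0. *)
Lemma hat_angle_lt1 (R : realType) (theta : R) : `|tan theta| <> 1 ->
  cos (hat_angle theta) != 0 /\ `|tan (hat_angle theta)| < 1.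
Proof.
move=> t1; have cs := cos2Dsin2 theta.
rewrite /hat_angle /pivot_ind; case: ltrP => [ltcs | lesc] /=.
  have sn0 : sin theta != 0 by rewrite -normr_gt0 (le_lt_trans _ ltcs).
  have cE : cos (pi / 2 - theta) = sin theta by rewrite -opprB cosN cosBpihalf.
  have sE : sin (pi / 2 - theta) = cos theta.
    by rewrite -opprB sinN sinBpihalf opprK.
  by rewrite /tan cE sE normrM normfV ltr_pdivrMr ?mul1r // normr_gt0.
have cn0 : cos theta != 0.
  apply: contraPneq cs => c0; move: lesc; rewrite c0 normr0 normr_le0 => /eqP->.
  by rewrite expr0n addr0 => /eqP; rewrite eq_sym oner_eq0.
split=> //; rewrite lt_neqAle; apply/andP; split; first exact/eqP.
by rewrite /tan normrM normfV ler_pdivrMr ?mul1r // normr_gt0.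
Qed.

Lemma rotUD_mxE (R : realType) (theta : R) (that := hat_angle theta) :
  rotU_mx that *m rotD_mx theta
  = mx2 ((-1) ^+ pivot_ind theta * cos that) (sin that) 0 (cos that)^-1.
Proof.
rewrite /rotU_mx /rotD_mx /pivot_ind; case: (_ < _).
  by rewrite !expr1 mulmx_mx2 !(mulr0, mulr1, addr0, add0r, mul0r) mulrC.
by rewrite !expr0 mulmx1 mul1r.
Qed.

(** For either value of the pivot indicator the row-permuted rotation is a
    rotation by the hat angle with its first column multiplied by
    [(-1) ^+ pivot_ind theta]; dividing by [cos that] gives the factors. *)
Lemma rotPR_LUD (R : realType) (theta : R) (that := hat_angle theta) :
  `|tan theta| <> 1 ->
  rotP_mx theta *m rot_mx theta
  = rotL_mx that *m (rotU_mx that *m rotD_mx theta).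
Proof.
move=> /hat_angle_lt1[cn0 _]; have cs := cos2Dsin2 that.
have -> : rotP_mx theta *m rot_mx theta
    = mx2 ((-1) ^+ pivot_ind theta * cos that) (sin that)
          (- ((-1) ^+ pivot_ind theta * sin that)) (cos that).
  rewrite /that /hat_angle /rotP_mx /rot_mx /pivot_ind; case: (_ < _) => /=.
    rewrite -opprB cosN cosBpihalf sinN sinBpihalf !expr1 mulmx_mx2.
    by rewrite !(mul0r, mul1r, add0r, addr0, mulN1r, opprK).
  by rewrite expr0 mul1mx !mul1r.
rewrite rotUD_mxE /rotL_mx mulmx_mx2 !(mul0r, mul1r, add0r, addr0, mulr0).
have tc : tan that * cos that = sin that by rewrite divfK.
congr mx2; first by rewrite mulNr mulrCA tc.
apply: (mulIf cn0); rewrite mulrDl mulVf // mulNr mulNr mulrAC tc -!expr2.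
by rewrite -cs addrC addrK.
Qed.

Lemma kron_rotP_is_perm (R : realType) (theta : R) (m : nat) :
  is_perm_mx (kron_id (rotP_mx theta) m).
Proof.
rewrite /rotP_mx /pivot_ind; case: (_ < _).
  by rewrite expr1 kron_idE raddf0 swap_is_perm.
rewrite expr0 -[1]/(1%:M) -mx2_1 kron_idE raddf0 -scalar_mx_block.
exact: is_perm_mx1.
Qed.

(** * The factorization of B *)

Lemma unit_lower_unitmx (R : comUnitRingType) (n : nat) (L : 'M[R]_n) :
  unit_lower L -> L \in unitmx.
Proof.
move=> hL; rewrite unitmxE det_trig; last first.
  apply/is_trig_mxP => i j ltij.
  by rewrite hL ?(ltnW ltij) // -val_eqE ltn_eqF.
by rewrite big1 ?unitr1 // => i _; rewrite hL // eqxx.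
Qed.

Lemma upper_unit_diag (R : fieldType) (n : nat) (U : 'M[R]_n) (k : 'I_n) :
  upper U -> U \in unitmx -> U k k != 0.
Proof.
move=> hU; rewrite unitmxE -det_tr det_trig; last first.
  by apply/is_trig_mxP => i j ltij; rewrite mxE hU.
rewrite (bigD1 k) //= mxE unitfE; apply: contraNneq => ->.
by rewrite mul0r.
Qed.

Theorem proposition1 (R : realType) (m : nat) (theta : R)
    (A1 A2 P1 L1 U1 P2 L2 U2 : 'M[R]_m)
    (htheta : `|tan theta| <> 1)
    (hA1 : A1 \in unitmx)
    (hgepp1 : is_gepp A1 P1 L1 U1)
    (hgepp2 : is_gepp A2 P2 L2 U2)
    (hL1 : forall i j : 'I_m, (j < i)%N -> `|L1 i j| < 1)
    (hL2 : forall i j : 'I_m, (j < i)%N -> `|L2 i j| < 1) :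
  let B := kron_id (rot_mx theta) m *m dsum A1 A2 in
  let that := hat_angle theta in
  let P := dsum P1 P2 *m kron_id (rotP_mx theta) m in
  let L := dsum P1 P2 *m kron_id (rotL_mx that) m
             *m dsum P1^T P2^T *m dsum L1 L2 in
  let U := dsum (invmx L1) (invmx L2) *m dsum P1 P2
             *m kron_id (rotU_mx that *m rotD_mx theta) m *m dsum A1 A2 in
  [/\ is_gepp B P L U,
      P *m B = L *m U,
      L = block_mx L1 0 (- tan that *: (P2 *m P1^T *m L1)) L2 &
      U = block_mx ((-1) ^+ pivot_ind theta * cos that *: U1)
                   (sin that *: (U1 *m invmx A1 *m A2))
                   0 ((cos that)^-1 *: U2)].
Proof.
move=> B that P L U.
have [cn0 tlt1] := hat_angle_lt1 htheta; rewrite -/that in cn0 tlt1.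
case: hgepp1 => /gepp_PLU[pP1 ulL1 uU1 PA1] _.
case: hgepp2 => /gepp_PLU[pP2 ulL2 uU2 PA2] U2nz.
have unL1 := unit_lower_unitmx ulL1; have unL2 := unit_lower_unitmx ulL2.
have PTK (Q : 'M[R]_m) : is_perm_mx Q -> Q^T *m Q = 1%:M /\ Q *m Q^T = 1%:M.
  move=> /is_perm_mxP[s ->].
  by rewrite tr_perm_mx -!perm_mxM mulgV mulVg perm_mx1.
have [P1K P1K'] := PTK _ pP1; have [P2K P2K'] := PTK _ pP2.
have PB : P *m B = L *m U.
  rewrite /P /L /U /B -!mulmxA (mulmxA (dsum L1 L2)) -dsumM !mulmxV // dsum1.
  rewrite mul1mx (mulmxA (dsum _^T _)) -dsumM P1K P2K dsum1 mul1mx.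
  rewrite !mulmxA -(mulmxA _ (kron_id _ _) (kron_id (rot_mx _) _)) -kron_idM.
  by rewrite rotPR_LUD // kron_idM !mulmxA.
have LE : L = block_mx L1 0 (- tan that *: (P2 *m P1^T *m L1)) L2.
  rewrite /L /rotL_mx kron_idE raddf0 /dsum !mulmx_block.
  rewrite !(mulmx0, mul0mx, addr0, add0r, mulmx1) P1K' P2K' !mul1mx.
  by rewrite mul_mx_scalar -!scalemxAl.
have U1E : invmx L1 *m P1 *m A1 = U1 by rewrite -mulmxA PA1 mulKmx.
have U2E : invmx L2 *m P2 *m A2 = U2 by rewrite -mulmxA PA2 mulKmx.
have UE : U = block_mx ((-1) ^+ pivot_ind theta * cos that *: U1)
                   (sin that *: (U1 *m invmx A1 *m A2))
                   0 ((cos that)^-1 *: U2).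
  rewrite /U rotUD_mxE kron_idE -dsumM /dsum !mulmx_block raddf0.
  rewrite !(mulmx0, mul0mx, addr0, add0r) !mul_mx_scalar -!scalemxAl U1E U2E.
  by rewrite -U1E mulmxK.
split=> //; apply: strict_PLU_is_gepp => //.
- rewrite /P is_perm_mxMl; last exact: dsum_is_perm.
  exact: kron_rotP_is_perm.
- rewrite LE => i j; rewrite -[i]splitK -[j]splitK.
  case: (split i) (split j) => [x | x] [y | y] /=;
  rewrite ?(block_mxEul, block_mxEur, block_mxEdl, block_mxEdr).
  + by move=> /ulL1 ->; rewrite eq_lshift.
  + by rewrite mxE eq_lrshift.
  + by rewrite leqNgt (leq_trans (ltn_ord y)) ?leq_addr.
  + by rewrite leq_add2l => /ulL2 ->; rewrite eq_rshift.
- rewrite UE => i j; rewrite -[i]splitK -[j]splitK.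
  case: (split i) (split j) => [x | x] [y | y] /=;
  rewrite ?(block_mxEul, block_mxEur, block_mxEdl, block_mxEdr).
  + by move=> ltyx; rewrite mxE uU1 // mulr0.
  + by rewrite ltnNge (leq_trans (ltnW (ltn_ord x))) ?leq_addr.
  + by rewrite mxE.
  + by rewrite ltn_add2l => ltyx; rewrite mxE uU2 // mulr0.
- rewrite LE => i j; rewrite -[i]splitK -[j]splitK.
  case: (split i) (split j) => [x | x] [y | y] /=;
  rewrite ?(block_mxEul, block_mxEur, block_mxEdl, block_mxEdr).
  + exact: hL1.
  + by rewrite ltnNge (leq_trans (ltnW (ltn_ord x))) ?leq_addr.
  + move=> _.
    have /is_perm_mxP[s ->] : is_perm_mx (P2 *m P1^T).
      by rewrite is_perm_mxMl // is_perm_mx_tr.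
    rewrite -row_permE !mxE normrM normrN.
    have le1 : `|L1 (s x) y| <= 1.
      have [lesy | /hL1/ltW //] := leqP (s x) y.
      by rewrite ulL1 //; case: (_ == _); rewrite ?normr1 ?normr0.
    by rewrite (le_lt_trans _ tlt1) // ler_piMr.
  + by rewrite ltn_add2l; exact: hL2.
- rewrite UE => k; rewrite -[k]splitK.
  case: (split k) => x /=; rewrite ?(block_mxEul, block_mxEdr) mxE.
    move=> _; rewrite !mulf_neq0 ?signr_eq0 // upper_unit_diag // -U1E.
    have /is_perm_mxP[s ->] := pP1.
    by rewrite !unitmx_mul unitmx_inv unL1 unitmx_perm.
  by rewrite -addnS ltn_add2l => /U2nz U2x; rewrite mulf_neq0 ?invr_eq0.
Qed.
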